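(* Let $\mathcal{P}$ be a partition of $\omega$ into infinitely many infinite sets and let $\mathcal{F}$ be a filter on $\omega$. If $\mathcal{F}\leq_{RK}\mathcal{F}_{\mathcal{P}}$, then either $\mathcal{F}$ is relatively equivalent to the Fréchet filter or $\mathcal{F}$ is equivalent to $\mathcal{F}_{\mathcal{P}}$.
   Context: All filters are proper free filters on $\omega$ (they contain all cofinite sets). $A\subseteq^* B$ means $A\setminus B$ is finite. For a nonempty family $\mathcal{D}$ of infinite subsets of $\omega$, $\mathcal{F}_{\mathcal{D}}=\{F\subseteq\omega:\forall D\in\mathcal{D}\ (D\subseteq^* F)\}$; $\mathcal{F}_{\mathcal{P}}$ is called the FAN-filter. For a function $f:\omega\to\omega$ and a filter $\mathcal{G}$, $f[\mathcal{G}]=\{X\subseteq\omega: f^{-1}(X)\in\mathcal{G}\}$. $\mathcal{F}\leq_{RK}\mathcal{G}$ means that there is a surjective $f:\omega\to\omega$ with $f[\mathcal{G}]=\mathcal{F}$. Two filters $\mathcal{F},\mathcal{G}$ are equivalent if $f[\mathcal{F}]=\mathcal{G}$ for some bijection $f:\omega\to\omega$. A filter $\mathcal{G}$ is relatively equivalent to the Fréchet filter if there is an infinite $A\subseteq\omega$ with $A\in\mathcal{G}$ and $A\subseteq^* G$ for every $G\in\mathcal{G}$. *)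

(* Defs.v *)
From mathcomp Require Import all_boot.
From mathcomp Require Import boolp classical_sets functions cardinality filter.

Set Implicit Arguments.
Unset Strict Implicit.
Unset Printing Implicit Defensive.

Local Open Scope classical_set_scope.

Definition free_filter (F : set_system nat) : Prop :=
  ProperFilter F /\ @frechet_filter nat `<=` F.

Definition almost_subset (A B : set nat) : Prop := finite_set (A `\` B).

(* When D is the family of blocks of a partition of nat into infinitely many
   infinite sets, this is the FAN-filter. *)
Definition family_filter (D : set (set nat)) : set_system nat :=
  [set F | forall A, D A -> almost_subset A F].

(* The image filter f[G] is the library's [fmap f G]; the notation [f @ G] is
   avoided because it inserts a coercion through [nbhs]. *)
Definition RK_le (F G : set_system nat) : Prop :=
  exists2 f : nat -> nat, set_surj setT setT f & fmap f G = F.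

Definition filter_equivalent (F G : set_system nat) : Prop :=
  exists2 f : nat -> nat, set_bij setT setT f & fmap f F = G.

Definition relatively_frechet (G : set_system nat) : Prop :=
  exists A : set nat,
    [/\ infinite_set A, G A & forall B, G B -> almost_subset A B].

(* The partition is the set of its blocks, i.e. a family indexed by itself;
   hence distinct blocks are disjoint. *)
Definition infinite_partition (P : set (set nat)) : Prop :=
  [/\ partition P id [set: nat], infinite_set P
    & forall A, P A -> infinite_set A].

(* Main.v *)
(** A partition of [nat] is encoded by a map [e] to indices, with blocks the
    fibers of [e].  Given a surjection [f] with [f[F_P] = F], where [P] is coded
    by [p], freeness of [F] makes [f] finite-to-one on every block, so [F] is
    generated by the sets almost containing all the images of blocks.
    Disjointifying these images, via the index [e x] = least [n] such that [x] is
    in the image of block [n], does not change the filter.  If only finitely many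
    fibers of [e] are infinite, their union witnesses relative equivalence to
    the Fréchet filter.  Otherwise the points of the finite fibers can be
    distributed among the infinite ones, finitely many to each, without changing
    the filter, and any two partitions into infinitely many infinite sets are
    conjugate by a bijection. *)

Require Import Defs.
From mathcomp Require Import all_boot.
From mathcomp Require Import boolp classical_sets functions cardinality filter.

Set Implicit Arguments.
Unset Strict Implicit.
Unset Printing Implicit Defensive.

Local Open Scope classical_set_scope.

Definition fiber (e : nat -> nat) (n : nat) : set nat := e @^-1` [set n].

(** Finite and empty fibers impose no condition, so [e] may be any map. *)
Definition fiber_filter (e : nat -> nat) : set_system nat :=
  [set X | forall n, almost_subset (fiber e n) X].

Definition infinite_indices (e : nat -> nat) : set nat :=
  [set n | infinite_set (fiber e n)].

Lemma infinite_nat_card_eq (A : set nat) :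
  infinite_set A -> (A #= [set: nat])%card.
Proof. by move=> Ainf; apply: eq_card_nat => //; exact: countableP. Qed.

Lemma infinite_nat_set_bij (A B : set nat) : infinite_set A -> infinite_set B ->
  exists f : nat -> nat, set_bij A B f.
Proof.
move=> /infinite_nat_card_eq cA /infinite_nat_card_eq cB.
by apply/card_set_bijP; rewrite (card_eq_trans cA)// card_eq_sym.
Qed.

(** Bijections between the fibers of equal index are chosen and glued together. *)
Lemma infinite_fibers_conjugate (p q : nat -> nat) :
    (forall n, infinite_set (fiber p n)) ->
    (forall n, infinite_set (fiber q n)) ->
  exists2 f : nat -> nat, set_bij setT setT f & forall x, q (f x) = p x.
Proof.
move=> pinf qinf.
have /choice[h hP] n := infinite_nat_set_bij (pinf n) (qinf n).
have qh x : q (h (p x) x) = p x by have [+ _ _] := hP (p x); apply.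
exists (fun x => h (p x) x) => //; split=> //.
  move=> x y _ _ hxy; have pxy : p x = p y by rewrite -qh hxy qh.
  move: hxy; rewrite pxy; have [_ + _] := hP (p y).
  by apply; rewrite inE.
move=> y _; have [_ _ /(_ y erefl)[x px hx]] := hP (q y).
by exists x => //; rewrite px.
Qed.

Lemma fiber_filter_equivalent (p q f : nat -> nat) : set_bij setT setT f ->
  (forall x, q (f x) = p x) -> fmap f (fiber_filter p) = fiber_filter q.
Proof.
move=> [_ finj fsurj] qf.
have f_inj x y : f x = f y -> x = y by apply: finj; rewrite inE.
apply/seteqP; split=> X /= FX n.
  apply: sub_finite_set (finite_image f (FX n)) => y [qy Xy].
  have [x _ fx] := fsurj y I; exists x => //.
  by split; [rewrite /fiber/= -qf fx|rewrite /= fx].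
apply: (@sub_finite_set _ _ (f @^-1` (fiber q n `\` X))) => [x [px Xx]|].
  by split=> //; rewrite /fiber/= qf.
by apply: finite_preimage (FX n) => x y _ _; exact: f_inj.
Qed.

(* The points of the finite fibers are spread over the infinite ones, the point
   [x] going to the infinite fiber of rank [x]. *)
Lemma fiber_filter_infinite (e : nat -> nat) : infinite_set (infinite_indices e) ->
  exists2 q : nat -> nat,
    forall n, infinite_set (fiber q n) & fiber_filter e = fiber_filter q.
Proof.
move=> Iinf.
have [g [_ ginj gsurj]] := infinite_nat_set_bij Iinf infinite_nat.
pose q x := if `[< infinite_indices e (e x) >] then g (e x) else x.
have fiberS m : infinite_indices e m -> fiber e m `<=` fiber q (g m).
  by move=> Im x /= em; rewrite /fiber /q /= em asboolT.
(* Outside the infinite fibers [q x = x], so the fiber of [q] at [g m] gains at most the single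
   point [g m]. *)
have fiberU m : infinite_indices e m -> fiber q (g m) `<=` fiber e m `|` [set g m].
  move=> Im x /=; rewrite /fiber /q /=; case: asboolP => [Ix gx|_ ->]; last by right.
  by left; apply: ginj; rewrite ?inE.
exists q.
  move=> n; have [m Im <-] := gsurj n I.
  by move=> /(sub_finite_set (fiberS m Im)); exact: Im.
apply/seteqP; split=> X FX n.
  have [m Im <-] := gsurj n I.
  apply: (@sub_finite_set _ _ ((fiber e m `\` X) `|` [set g m])).
    by move=> x [/(fiberU m Im)[?|?] ?]; [left|right].
  by rewrite finite_setU; split; [exact: FX|exact: finite_set1].
have [Im|/contrapT fin] := pselect (infinite_indices e n).
  by apply: sub_finite_set (FX (g n)); apply: setSD; exact: fiberS.
by apply: sub_finite_set fin; exact: subDsetl.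
Qed.

Lemma fiber_filter_finite (e : nat -> nat) : ProperFilter (fiber_filter e) ->
  finite_set (infinite_indices e) -> relatively_frechet (fiber_filter e).
Proof.
move=> Fproper Ifin; pose A := e @^-1` infinite_indices e.
have FA : fiber_filter e A.
  move=> n; have [In|/contrapT fin] := pselect (infinite_indices e n).
    apply: (@sub_finite_set _ _ set0) => // x [ex]; apply.
    by rewrite /A /= ex.
  by apply: sub_finite_set fin; exact: subDsetl.
have sub B : fiber_filter e B -> almost_subset A B.
  move=> FB; apply: sub_finite_set (bigcup_finite Ifin (fun n _ => FB n)).
  by move=> x [Ax Bx]; exists (e x).
(* A finite [A] would make every fiber finite, putting the empty set in the filter. *)
exists A; split=> // Afin; apply: (@filter_not_empty _ (fiber_filter e)) => n.
apply: (@sub_finite_set _ _ (A `|` (fiber e n `\` A))).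
  by move=> x [ex _]; have [Ax|nAx] := pselect (A x); [left|right].
by rewrite finite_setU; split=> //; exact: FA.
Qed.

Lemma fiber_filter_image (p f : nat -> nat) : set_surj setT setT f ->
    (forall x, fmap f (fiber_filter p) (~` [set x])) ->
  exists e : nat -> nat, fmap f (fiber_filter p) = fiber_filter e.
Proof.
move=> fsurj free.
have /choice[e eP] x : exists n, (exists2 y, f y = x & p y = n) /\
    forall y, f y = x -> n <= p y.
  have ex : exists n, `[< exists2 y, f y = x & p y = n >].
    by have [y _ fy] := fsurj x I; exists (p y); apply/asboolP; exists y.
  case: (ex_minnP ex) => n /asboolP nP nmin; exists n; split=> // y fy.
  by apply: nmin; apply/asboolP; exists y.
exists e; apply/seteqP; split=> X FX n.
  apply: sub_finite_set (finite_image f (FX n)) => x [ex Xx].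
  have [[y fy py] _] := eP x; exists y => //.
  by split; [rewrite /fiber/= py|rewrite /= fy].
(* If [p y = n] and [f y] is outside [X], then [e (f y) <= n] by minimality, so [f y] takes finitely
   many values; by [free], each has finitely many preimages in the fiber of [p] at [n]. *)
have fin_bad : finite_set (\bigcup_(k in `I_n.+1) (fiber e k `\` X)).
  by apply: bigcup_finite => // k _; exact: FX.
have fin1 x : finite_set (fiber p n `\` f @^-1` (~` [set x])) by exact: free.
apply: sub_finite_set (bigcup_finite fin_bad (fun x _ => fin1 x)).
move=> y [py Xy]; exists (f y).
  exists (e (f y)); last by [].
  by have [_ /(_ y erefl)] := eP (f y); rewrite /= ltnS py.
by split=> //=; apply.
Qed.

Lemma partition_fiber_filter (P : set (set nat)) : infinite_partition P ->
  exists2 p : nat -> nat,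
    infinite_set (infinite_indices p) & family_filter P = fiber_filter p.
Proof.
move=> [[Pcover Ptriv Pne] Pinf Ainf].
have /choice[B BP] x : exists A, P A /\ A x.
  by have [A PA Ax] : cover P id x by [rewrite Pcover]; exists A.
have BE A x : P A -> A x -> B x = A.
  move=> PA Ax; have [PB Bx] := BP x.
  by apply: Ptriv => //; exists x.
(* Each block is indexed by a chosen point of it; blocks are nonempty, so the default [0] does no
   harm. *)
pose r (A : set nat) := xget 0 A.
have rP A : P A -> A (r A) by move=> /Pne[x Ax]; exact: (xgetI 0 Ax).
pose p x := r (B x).
have fiberE A : P A -> fiber p (r A) = A.
  move=> PA; apply/seteqP; split=> x.
    rewrite /fiber /= => rE; have [PB Bx] := BP x.
    by rewrite -(BE A _ PA (rP _ PA)) -rE (BE (B x) _ PB (rP _ PB)).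
  by move=> Ax; rewrite /fiber /= /p (BE A).
exists p.
  move=> /(finite_image (fiber p)) fin; apply: Pinf.
  apply: sub_finite_set fin => A PA; exists (r A); last exact: fiberE.
  by rewrite /infinite_indices /= fiberE //; exact: Ainf.
apply/seteqP; split=> X FX; last first.
  by move=> A PA; rewrite -(fiberE A PA); exact: FX.
move=> n; have [[x <-]|nn] := pselect (exists x, p x = n).
  by have [PB _] := BP x; rewrite fiberE //; exact: FX.
apply: (@sub_finite_set _ _ set0) => // x [px _].
by apply: nn; exists x.
Qed.

Theorem theorem3p3 (P : set (set nat)) (F : set_system nat)
    (hP : infinite_partition P) (hF : free_filter F)
    (hRK : RK_le F (family_filter P)) :
  relatively_frechet F \/ filter_equivalent F (family_filter P).
Proof.
have [p pinf PE] := partition_fiber_filter hP.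
have [f fsurj FE] := hRK; have [Fproper Ffree] := hF; rewrite PE in FE.
have free x : fmap f (fiber_filter p) (~` [set x]).
  rewrite FE; apply: Ffree; rewrite /frechet_filter /= setCK.
  exact: finite_set1.
have [e eE] := fiber_filter_image fsurj free.
rewrite FE in eE; rewrite eE in Fproper *.
have [Ifin|Iinf] := pselect (finite_set (infinite_indices e)).
  by left; exact: fiber_filter_finite.
right; have [q qinf ->] := fiber_filter_infinite Iinf.
(* Numbers that are not the chosen point of a block have empty fibers under [p], so [p] too is
   recoded before conjugating. *)
have [q' q'inf q'E] := fiber_filter_infinite pinf.
have [h hbij hE] := infinite_fibers_conjugate qinf q'inf.
by exists h => //; rewrite PE q'E; exact: fiber_filter_equivalent.
Qed.
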